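(* Let $q\ge 1$ and let $R=\mathbf{Z}[B_{i,j} : 1\le i,j\le q]$ be the commutative polynomial ring over $\mathbf{Z}$ in the $q^2$ independent indeterminates $B_{i,j}$. For $1\le n\le q$ let $$C_{n,n}=\sum_{(i_1,\ldots,i_c)\in D_n} B_{n,i_1}B_{i_1,i_2}B_{i_2,i_3}\cdots B_{i_{c-1},i_c}B_{i_c,n}\in R,$$ where $D_n$ is the set of admissible sequences with entries in $\{1,\ldots,n-1\}$. Let $\prec$ be the lexicographic term order on the monomials of $R$ induced by any total order of the indeterminates in which every diagonal indeterminate $B_{i,i}$ is larger than every off-diagonal indeterminate $B_{k,l}$, $k\neq l$. Then the polynomials $1+C_{n,n}$, $n=1,\ldots,q$, form the reduced Gröbner basis with respect to $\prec$ of the ideal $$I=\left\langle \det\left(B_{i,j}\right)_{1\le i,j\le n}-(-1)^n \;:\; n=1,\ldots,q\right\rangle\subset R.$$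
   Context: A finite sequence of positive integers is called admissible if for all $s\ge 1$, between any two appearances of $s$ in the sequence there is a number greater than $s$ which appears between them. For $n\ge 1$, $D_n$ denotes the set of all admissible sequences composed of the numbers $1,2,\ldots,n-1$ (including the empty sequence; $D_1=\{\varnothing\}$). The empty sequence contributes the term $B_{n,n}$ to $C_{n,n}$; for instance $C_{1,1}=B_{1,1}$ and $C_{2,2}=B_{2,2}+B_{2,1}B_{1,2}$. The term order is purely lexicographic, not degree lexicographic; for example $B_{2,2}\succ B_{2,1}B_{1,2}$. A finite subset $G$ of an ideal $I$ is a Gröbner basis of $I$ with respect to $\prec$ if the initial terms (leading coefficient times leading monomial) of the elements of $G$ generate the initial ideal of $I$, i.e. the ideal generated by the initial terms of all non-zero elements of $I$. It is reduced if all leading coefficients are $1$ and, for every $g\in G$, no monomial occurring in $g$ is divisible by the leading monomial of another element of $G$. *)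

(* Defs.v *)
From HB Require Import structures.
From mathcomp Require Import all_boot all_order all_algebra.
From mathcomp Require Import mpoly.

Set Implicit Arguments.
Unset Strict Implicit.
Unset Printing Implicit Defensive.

Import GRing.Theory.

Section Admissible.
Local Open Scope nat_scope.

Definition admissible (s : seq nat) : bool :=
  [forall j : 'I_(size s), forall i : 'I_j,
    (nth 0 s i == nth 0 s j) ==>
      [exists k : 'I_j, (i < k) && (nth 0 s i < nth 0 s k)]].

Lemma admissibleP (s : seq nat) :
  reflect (forall i j, i < j -> j < size s -> nth 0 s i = nth 0 s j ->
             exists k, [/\ i < k, k < j & nth 0 s i < nth 0 s k])
          (admissible s).
Proof.
apply: (iffP forallP) => [h i j ij js e | h j].
  have /forallP/(_ (Ordinal ij))/= := h (Ordinal js).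
  rewrite e eqxx /= => /existsP[k /andP[ik lk]].
  by exists k; split; rewrite ?e.
apply/forallP => i; apply/implyP => /eqP e.
have [k [ik kj lk]] := h i j (ltn_ord i) (ltn_ord j) e.
by apply/existsP; exists (Ordinal kj); rewrite /= ik.
Qed.

Lemma admissible_catl (s t : seq nat) : admissible (s ++ t) -> admissible s.
Proof.
move=> /admissibleP h; apply/admissibleP => i j ij js e.
have is_ := ltn_trans ij js.
have [||k [ik kj lk]] := h i j ij.
- by rewrite size_cat ltn_addr.
- by rewrite !nth_cat is_ js.
exists k; split=> //; move: lk.
by rewrite !nth_cat is_ (ltn_trans kj js).
Qed.

Lemma admissible_catr (s t : seq nat) : admissible (s ++ t) -> admissible t.
Proof.
have E i : nth 0 (s ++ t) (size s + i) = nth 0 t i.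
  by rewrite nth_cat ltnNge leq_addr /= addKn.
move=> /admissibleP h; apply/admissibleP => i j ij js e.
have [|||k [ik kj lk]] := h (size s + i) (size s + j).
- by rewrite ltn_add2l.
- by rewrite size_cat ltn_add2l.
- by rewrite !E.
have sk : size s <= k by apply: leq_trans (ltnW ik); apply: leq_addr.
move: ik kj lk; rewrite -(subnKC sk) !ltn_add2l !E => ik kj lk.
by exists (k - size s).
Qed.

Lemma size_admissible (n : nat) (s : seq nat) :
  admissible s -> all (ltn^~ n) s -> size s < 2 ^ n.
Proof.
elim: n s => [|n IH] s adm sn; first by case: s {adm} sn.
have lt_n t : all (ltn^~ n.+1) t -> n \notin t -> all (ltn^~ n) t.
  move=> /allP tn nt; apply/allP => x xt; have := tn x xt.
  by rewrite /= ltnS leq_eqVlt; case: eqP => // xE; rewrite -xE xt in nt.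
have [ns|ns] := boolP (n \in s); last first.
  rewrite expnS mul2n -addnn; apply: ltn_addr; apply: IH => //; exact: lt_n.
move: adm sn; case/splitPr: ns => s1 s2 adm sn.
move: (sn); rewrite all_cat /= => /and3P[sn1 _ sn2].
have no_n t1 t2 t3 : admissible (t1 ++ n :: t2 ++ n :: t3) ->
    all (ltn^~ n.+1) t2 -> False.
  move=> /admissible_catr; rewrite -cat_cons -(cat1s n t3) catA.
  move=> /admissible_catl/admissibleP/(_ 0 (size t2).+1 isT).
  rewrite size_cat /= addn1 ltnS leqnn nth_cat ltnn subnn.
  move=> /(_ isT erefl)[[|k] [//= _ kt]].
  rewrite ltnS in kt.
  rewrite nth_cat kt => nk /allP/(_ _ (mem_nth 0 kt))/=.
  by rewrite ltnS leqNgt nk.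
have ns1 : n \notin s1.
  apply/negP => ns1; move: adm sn1; case/splitPr: ns1 => a b.
  rewrite -catA /= all_cat /= => adm /and3P[_ _ bn].
  exact: no_n adm bn.
have ns2 : n \notin s2.
  apply/negP => ns2; move: adm sn2; case/splitPr: ns2 => a b.
  rewrite all_cat /= => adm /andP[an _].
  exact: no_n adm an.
have l1 : size s1 < 2 ^ n by apply: IH (lt_n _ sn1 ns1); apply: admissible_catl adm.
have l2 : size s2 < 2 ^ n.
  apply: IH (lt_n _ sn2 ns2); apply: (@admissible_catr [:: n]).
  exact: (@admissible_catr s1).
by rewrite size_cat /= expnS mul2n -addnn addnS -addSn -addnS leq_add.
Qed.

(* Indices are 0-based: n : 'I_q stands for the index n + 1, and admissibility
   only depends on the relative order of the entries.  The bound on the length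
   loses nothing, see mem_adm_seqs. *)
Definition adm_seqs (q : nat) (n : 'I_q) : seq (seq 'I_q) :=
  flatten [seq [seq tval t | t : k.-tuple 'I_q <- enum {: k.-tuple 'I_q}
                          & admissible (map val t) && all (fun i : 'I_q => i < n) t]
          | k <- iota 0 (2 ^ n)].

Lemma mem_adm_seqs (q : nat) (n : 'I_q) (s : seq 'I_q) :
  (s \in adm_seqs n) =
  admissible (map val s) && all (fun i : 'I_q => i < n) s.
Proof.
apply/flatten_mapP/idP => [[k _ /mapP[t]] | sP].
  by rewrite mem_filter => /andP[tP _] ->.
exists (size s); last first.
  by apply/mapP; exists (in_tuple s); rewrite // mem_filter sP mem_enum.
rewrite mem_iota /= add0n -(size_map val s).
by case/andP: sP => sa sn; apply: size_admissible => //; rewrite all_map.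
Qed.

Lemma adm_seqs_uniq (q : nat) (n : 'I_q) : uniq (adm_seqs n).
Proof.
rewrite /adm_seqs; elim: (iota 0 _) (iota_uniq 0 (2 ^ n)) => //= k r IH.
case/andP=> kr /IH{}IH; rewrite cat_uniq IH andbT.
rewrite map_inj_uniq; last exact: val_inj.
rewrite filter_uniq ?enum_uniq //=.
apply/hasPn => s /flatten_mapP[l lr /mapP[t _ ->]].
apply/mapP => -[u _ /(congr1 size)]; rewrite !size_tuple => lk.
by rewrite -lk lr in kr.
Qed.

End Admissible.

Local Open Scope ring_scope.

Definition ideal_gen (R : comNzRingType) (S : R -> Prop) (x : R) : Prop :=
  exists s : seq (R * R),
    (forall u, u \in s -> S u.2) /\ x = \sum_(u <- s) u.1 * u.2.

Section Groebner.
Variables (n : nat) (R : comNzRingType).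
Implicit Types (m : 'X_{1..n}) (p g h : {mpoly R[n]}) (lt : rel 'X_{1..n}).

(* mlex le m1 m2: m1 is strictly smaller than m2 in the purely lexicographic
   order in which 'X_i is at most 'X_j when le i j.  The order on 'X_{1..n}
   provided by mpoly is graded, hence unrelated to this one. *)
Definition mlex (le : rel 'I_n) : rel 'X_{1..n} := fun m1 m2 =>
  [exists i, (m1 i < m2 i)%N
     && [forall j, (j != i) && le i j ==> (m1 j == m2 j)]].

(* Relational, so that 0 has neither a leading monomial nor an initial term. *)
Definition lead_monom lt p m : Prop :=
  m \in msupp p /\ forall m', m' \in msupp p -> m' != m -> lt m' m.

Definition init_term lt p (t : {mpoly R[n]}) : Prop :=
  exists2 m, lead_monom lt p m & t = p@_m *: 'X_[m].

Definition init_ideal lt (I : {mpoly R[n]} -> Prop) : {mpoly R[n]} -> Prop :=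
  ideal_gen (fun t => exists p, [/\ I p, p != 0 & init_term lt p t]).

Definition groebner_basis lt (I : {mpoly R[n]} -> Prop)
    (G : seq {mpoly R[n]}) : Prop :=
  (forall g, g \in G -> I g) /\
  (forall p, ideal_gen (fun t => exists2 g, g \in G & init_term lt g t) p
             <-> init_ideal lt I p).

(* On monomials, (m1 <= m2)%MM is divisibility. *)
Definition reduced_groebner_basis lt (I : {mpoly R[n]} -> Prop)
    (G : seq {mpoly R[n]}) : Prop :=
  [/\ groebner_basis lt I G,
      forall g, g \in G -> exists2 m, lead_monom lt g m & g@_m = 1
    & forall g h m m', g \in G -> h \in G -> h != g ->
        m \in msupp g -> lead_monom lt h m' -> ~~ (m' <= m)%MM].

End Groebner.

Section Indeterminates.
Variable q : nat.

Definition B : 'M[{mpoly int[q * q]}]_q :=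
  \matrix_(i < q, j < q) 'X_(mxvec_index i j).

(* The zip is the list of steps of the closed walk n, i_1, ..., i_c, n. *)
Definition C (n : 'I_q) : {mpoly int[q * q]} :=
  \sum_(s <- adm_seqs n) \prod_(e <- zip (n :: s) (rcons s n)) B e.1 e.2.

(* The leading principal minor of size n + 1. *)
Definition lead_minor (n : 'I_q) : {mpoly int[q * q]} :=
  \det (mxsub (widen_ord (ltn_ord n)) (widen_ord (ltn_ord n)) B).

Definition minor_ideal : {mpoly int[q * q]} -> Prop :=
  ideal_gen (fun p => exists n : 'I_q, p = lead_minor n - (-1) ^+ n.+1).

End Indeterminates.

(* Main.v *)
(* Splitting an admissible sequence at its largest possible entry, which occurs
   at most once, shows that the path sums over admissible sequences with entries
   below m satisfy A_(m+1) i j = A_m i j + A_m i m * A_m m j: Gaussian elimination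
   of B with each pivot A_m m m = C m replaced by -1.  Hence, modulo the 1 + C k
   with k < n, the n-th leading minor is (-1)^n C n (indices from 0), so that the
   1 + C n generate the ideal.  Moreover 1 + C n is B n n plus a polynomial in
   off-diagonal indeterminates only.  Solving for B n n gives a substitution that
   kills the ideal and fixes the polynomials without diagonal indeterminates; so
   no nonzero element of the ideal is of the latter kind, and as the diagonal
   indeterminates are the largest ones, each leading monomial of an element of
   the ideal is divisible by one of them. *)

Require Import Defs.
From HB Require Import structures.
From mathcomp Require Import all_boot all_order all_algebra.
From mathcomp Require Import mpoly.

Set Implicit Arguments.
Unset Strict Implicit.
Unset Printing Implicit Defensive.

Import GRing.Theory.
Local Open Scope ring_scope.

(** * Admissible sequences split at their largest entry *)

Section AdmissibleSequences.
Local Open Scope nat_scope.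

Lemma lt_notin (n : nat) (s : seq nat) : all (ltn^~ n) s -> n \notin s.
Proof. by move=> /allP h; apply/negP => /h /=; rewrite ltnn. Qed.

Lemma all_lt_notin (n : nat) (s : seq nat) :
  all (ltn^~ n.+1) s -> n \notin s -> all (ltn^~ n) s.
Proof.
move=> /allP sn ns; apply/allP => x xs; have := sn x xs.
by rewrite /= ltnS leq_eqVlt; case: eqP => // xE; rewrite -xE xs in ns.
Qed.

(** Equal entries on opposite sides of [n] are separated by [n], which exceeds both, so only pairs
    within [s] or within [t] impose a condition. *)
Lemma admissible_cat_max (n : nat) (s t : seq nat) :
  all (ltn^~ n) s -> all (ltn^~ n) t ->
  admissible (s ++ n :: t) = admissible s && admissible t.
Proof.
move=> sn tn; apply/idP/andP => [st|[sa ta]].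
  split; first exact: admissible_catl st.
  by move: st; rewrite -cat1s catA; apply: admissible_catr.
apply/admissibleP => i j ij.
rewrite size_cat /= addnS ltnS => js.
have Es k : k < size s -> nth 0 (s ++ n :: t) k = nth 0 s k.
  by rewrite nth_cat => ->.
have En : nth 0 (s ++ n :: t) (size s) = n by rewrite nth_cat ltnn subnn.
have Et k : nth 0 (s ++ n :: t) ((size s).+1 + k) = nth 0 t k.
  by rewrite addSnnS nth_cat ltnNge leq_addr /= addKn.
have lt_s k : k < size s -> nth 0 s k < n by move=> ks; apply: (all_nthP _ sn).
have lt_t k : k < size t -> nth 0 t k < n by move=> kt; apply: (all_nthP _ tn).
have [lt_js|lt_sj|jE] := ltngtP j (size s).
- have is_ := ltn_trans ij lt_js; rewrite !Es // => e.
  have [k [ik kj lk]] := admissibleP _ sa i j ij lt_js e.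
  by exists k; rewrite Es // (ltn_trans kj).
- move: js ij; rewrite -(subnKC lt_sj) Et {1}addSn -addnS leq_add2l.
  move: (j - _) => {lt_sj}j js.
  have [lt_is|lt_si|->] := ltngtP i (size s).
  + move=> _ _; exists (size s); split=> //; first by rewrite addSn ltnS leq_addr.
    by rewrite Es // En lt_s.
  + rewrite -(subnKC lt_si) Et ltn_add2l; move: (i - _) => {lt_si}i ij e.
    have [k [ik kj lk]] := admissibleP _ ta i j ij js e.
    by exists ((size s).+1 + k); rewrite !ltn_add2l Et.
  + by rewrite En => _ nE; have := lt_t _ js; rewrite -nE ltnn.
- move: ij; rewrite jE En => is_; rewrite Es // => nE.
  by have := lt_s _ is_; rewrite nE ltnn.
Qed.

(** Two copies of [n] would need a larger entry between them. *)
Lemma admissible_max_notin (n : nat) (s t : seq nat) :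
  admissible (s ++ n :: t) -> all (ltn^~ n.+1) s -> all (ltn^~ n.+1) t ->
  (n \notin s) && (n \notin t).
Proof.
have no_n t1 t2 t3 : admissible (t1 ++ n :: t2 ++ n :: t3) ->
    all (ltn^~ n.+1) t2 -> False.
  move=> /admissible_catr; rewrite -cat_cons -(cat1s n t3) catA.
  move=> /admissible_catl/admissibleP/(_ 0 (size t2).+1 isT).
  rewrite size_cat /= addn1 ltnS leqnn nth_cat ltnn subnn.
  move=> /(_ isT erefl)[[|k] [//= _ kt]].
  rewrite ltnS in kt.
  rewrite nth_cat kt => nk /allP/(_ _ (mem_nth 0 kt))/=.
  by rewrite ltnS leqNgt nk.
move=> adm sn tn; apply/andP; split; apply/negP => ns.
  move: adm sn; case/splitPr: ns => a b.
  by rewrite -catA /= all_cat /= => adm /and3P[_ _]; apply: no_n adm.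
move: adm tn; case/splitPr: ns => a b.
by rewrite all_cat /= => adm /andP[an _]; apply: no_n adm an.
Qed.

(** Adjacent positions leave no room for a separating entry. This keeps diagonal indeterminates out
    of the inner steps of a walk. *)
Lemma admissible_neq (s t : seq nat) (a b : nat) :
  admissible (s ++ a :: b :: t) -> a != b.
Proof.
move=> /admissible_catr; rewrite -(cat1s b t) -cat_cons => /admissible_catl adm.
apply/eqP => ab; have [k []] := admissibleP _ adm 0 1 isT isT ab.
by case: k.
Qed.

Lemma mem_adm_seqsE (q : nat) (n : 'I_q) (s : seq 'I_q) :
  (s \in adm_seqs n) =
  admissible (map val s) && all (ltn^~ n) (map val s).
Proof. by rewrite mem_adm_seqs all_map. Qed.

Lemma adm_seqs0 (q : nat) (n : 'I_q) : n = 0 :> nat -> adm_seqs n = [:: [::]].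
Proof.
move=> n0; apply: perm_small_eq => //.
apply: uniq_perm; rewrite ?adm_seqs_uniq // => s.
rewrite mem_adm_seqs inE n0; case: s => [|a s] /=; last by rewrite andbF.
by rewrite andbT eqxx; apply/admissibleP.
Qed.

Lemma adm_seqsS (q : nat) (m n : 'I_q) : n = m.+1 :> nat ->
  perm_eq (adm_seqs n)
    (adm_seqs m ++ [seq s ++ m :: t | s <- adm_seqs m, t <- adm_seqs m]).
Proof.
move=> nE.
have notin s : s \in adm_seqs m -> m \notin s.
  rewrite mem_adm_seqsE => /andP[_ /lt_notin].
  by apply: contra => ms; apply/mapP; exists m.
apply: uniq_perm; first exact: adm_seqs_uniq.
  rewrite cat_uniq adm_seqs_uniq allpairs_uniq ?adm_seqs_uniq ?andbT //=.
    apply/hasPn => _ /allpairsP[[s t] /= [_ _ ->]]; apply/negP => /notin.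
    by rewrite mem_cat inE eqxx orbT.
  (* The first occurrence of [m] is at position [size s], so the concatenation determines both [s]
     and [t]. *)
  have idx s t : s \in adm_seqs m -> index m (s ++ m :: t) = size s.
    by move=> /notin ms; rewrite index_cat (negPf ms) /= eqxx addn0.
  move=> [s t] [s' t'] /allpairsP[[? ?] /= [sm _ [-> _]]].
  move=> /allpairsP[[? ?] /= [sm' _ [-> _]]] /[dup] /(congr1 (index m)).
  rewrite !idx // => ss /eqP; rewrite eqseq_cat // => /andP[/eqP->].
  by rewrite eqseq_cons => /andP[_ /eqP->].
move=> s; rewrite mem_cat mem_adm_seqsE nE.
apply/andP/orP => [[adm sn] | [|/allpairsP[[s1 s2] /= [h1 h2 ->]]]].
- have [ms|ms] := boolP (m \in s); last first.
    left; rewrite mem_adm_seqsE adm all_lt_notin //.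
    by rewrite mem_map //; apply: val_inj.
  right; case/splitPr: ms adm sn => s1 s2; rewrite map_cat /= all_cat /=.
  move=> adm /and3P[sn1 _ sn2].
  have /andP[ns1 ns2] := admissible_max_notin adm sn1 sn2.
  have {ns1}sn1 := all_lt_notin sn1 ns1; have {ns2}sn2 := all_lt_notin sn2 ns2.
  move: adm; rewrite admissible_cat_max // => /andP[a1 a2].
  by apply: allpairs_f; rewrite mem_adm_seqsE ?a1 ?a2.
- rewrite mem_adm_seqsE => /andP[-> /allP sm]; split=> //.
  by apply/allP => x /sm /= /ltnW.
move: h1 h2; rewrite !mem_adm_seqsE => /andP[a1 l1] /andP[a2 l2].
rewrite map_cat /= admissible_cat_max // a1 a2 all_cat /= ltnSn.
split=> //; apply/andP; split; apply/allP => x xs; apply: leqW.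
  exact: (allP l1).
exact: (allP l2).
Qed.

End AdmissibleSequences.

(** * Path sums and their elimination recurrence *)

Section PathSums.
Variables (R : comNzRingType) (q : nat) (b : 'M[R]_q).
Implicit Types (i j k m n : 'I_q) (s t : seq 'I_q).

Definition path_weight i s j : R :=
  \prod_(e <- zip (i :: s) (rcons s j)) b e.1 e.2.

(** By conversion, [C n] is [path_sum (B q) n n n]; the recurrence also involves other endpoints. *)
Definition path_sum n i j : R := \sum_(s <- adm_seqs n) path_weight i s j.

Lemma path_weight_cat i s k t j :
  path_weight i (s ++ k :: t) j = path_weight i s k * path_weight k t j.
Proof.
rewrite /path_weight -big_cat /= -zip_cat ?size_rcons //=.
by rewrite rcons_cat /= cat_rcons.
Qed.

Lemma path_sum0 n i j : n = 0%N :> nat -> path_sum n i j = b i j.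
Proof.
by move=> n0; rewrite /path_sum adm_seqs0 // big_seq1 /path_weight /= big_seq1.
Qed.

(* This is a step of Gaussian elimination in which the pivot
   [path_sum m m m] is replaced by -1. *)
Lemma path_sumS m n i j : n = m.+1 :> nat ->
  path_sum n i j = path_sum m i j + path_sum m i m * path_sum m m j.
Proof.
move=> nE; rewrite /path_sum (perm_big _ (adm_seqsS nE)) big_cat /=; congr (_ + _).
rewrite big_allpairs_dep big_distrl /=; apply: eq_bigr => s _.
by rewrite big_distrr; apply: eq_bigr => t _; rewrite path_weight_cat.
Qed.

(** Unrolls [path_sumS] down to stage 0, with one summand for each pivot [k]. This is the entrywise
    form of the factorization [elim_factor]. *)
Lemma path_sum_expand n i j :
  path_sum n i j
  = b i j + \sum_(k < q | (k < n)%N) path_sum k i k * path_sum k k j.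
Proof.
case: n => n; elim: n => [|n IH] nq.
  by rewrite path_sum0 // big_pred0 ?addr0.
have n'q := ltnW nq.
rewrite (@path_sumS (Ordinal n'q)) // IH -addrA; congr (_ + _).
rewrite [RHS](bigD1 (Ordinal n'q)) //= addrC; congr (_ + _).
by apply: eq_bigl => k; rewrite ltnS -val_eqE /= [LHS]ltn_neqAle andbC.
Qed.

(** The step with pivot [j] turns column [j] into multiples of [1 + path_sum b j j j]; later steps
    only add multiples of entries of that same column. *)
Lemma path_sum_below n i j : (j < n)%N ->
  exists c, path_sum n i j = c * (1 + path_sum j j j).
Proof.
case: n => n; elim: n i => [//|n IH] i nq /=; rewrite ltnS => jn.
have n'q := ltnW nq; rewrite (@path_sumS (Ordinal n'q)) //.
move: jn; rewrite leq_eqVlt => /orP[/eqP jE|jn].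
  have -> : Ordinal n'q = j by apply: val_inj.
  by exists (path_sum j i j); rewrite mulrDr mulr1.
have [c ->] := IH i n'q jn; have [d ->] := IH (Ordinal n'q) n'q jn.
by exists (c + path_sum (Ordinal n'q) i (Ordinal n'q) * d); rewrite mulrDl mulrA.
Qed.

End PathSums.

(** * Generated ideals and congruence of determinants *)

Section Ideals.
Variables (R : comNzRingType).
Implicit Types (S T : R -> Prop) (x y : R).

Lemma ideal_gen0 S : ideal_gen S 0.
Proof. by exists [::]; split=> //; rewrite big_nil. Qed.

Lemma ideal_genD S x y : ideal_gen S x -> ideal_gen S y -> ideal_gen S (x + y).
Proof.
move=> [s [sS ->]] [t [tS ->]]; exists (s ++ t); rewrite big_cat; split=> // u.
by rewrite mem_cat => /orP[/sS|/tS].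
Qed.

Lemma ideal_genM S x y : ideal_gen S y -> ideal_gen S (x * y).
Proof.
move=> [s [sS ->]]; exists [seq (x * u.1, u.2) | u <- s]; split.
  by move=> _ /mapP[u us ->] /=; apply: sS.
by rewrite big_map mulr_sumr; apply: eq_bigr => u _; rewrite mulrA.
Qed.

Lemma ideal_genN S x : ideal_gen S x -> ideal_gen S (- x).
Proof. by move=> Sx; rewrite -mulN1r; apply: ideal_genM. Qed.

Lemma ideal_genB S x y : ideal_gen S x -> ideal_gen S y -> ideal_gen S (x - y).
Proof. by move=> Sx Sy; apply/ideal_genD/ideal_genN. Qed.

Lemma sub_ideal_gen S x : S x -> ideal_gen S x.
Proof.
by move=> Sx; exists [:: (1, x)]; rewrite big_seq1 mul1r; split=> // u;
  rewrite inE => /eqP->.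
Qed.

Lemma ideal_gen_ind S (P : R -> Prop) : P 0 ->
  (forall x y, P x -> P y -> P (x + y)) -> (forall x y, S y -> P (x * y)) ->
  forall x, ideal_gen S x -> P x.
Proof.
move=> P0 PD PM x [s [sS ->]]; rewrite big_seq; apply: big_rec => // u y us.
by apply: PD; apply/PM/sS.
Qed.

Lemma ideal_gen_sub S T x :
  (forall y, S y -> ideal_gen T y) -> ideal_gen S x -> ideal_gen T x.
Proof.
move=> ST; apply: ideal_gen_ind; first exact: ideal_gen0.
  by move=> y z; apply: ideal_genD.
by move=> y z /ST; apply: ideal_genM.
Qed.

Lemma ideal_gen_prod S (I : finType) (F G : I -> R) :
  (forall i, ideal_gen S (F i - G i)) ->
  ideal_gen S (\prod_i F i - \prod_i G i).
Proof.
move=> FG; apply: (big_rec2 (fun x y => ideal_gen S (x - y))).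
  by rewrite subrr; apply: ideal_gen0.
move=> i x y _ xy.
have -> : F i * x - G i * y = F i * (x - y) + y * (F i - G i).
  by rewrite !mulrBr ![y * _]mulrC addrA addrNK.
by apply: ideal_genD; apply: ideal_genM.
Qed.

Lemma ideal_gen_det S (n : nat) (M N : 'M[R]_n) :
  (forall i j, ideal_gen S (M i j - N i j)) -> ideal_gen S (\det M - \det N).
Proof.
move=> MN; apply: (big_ind2 (fun x y => ideal_gen S (x - y))).
- by rewrite subrr; apply: ideal_gen0.
- by move=> x y z t xy zt; rewrite opprD addrACA; apply: ideal_genD.
- by move=> s _; rewrite -mulrBr; apply/ideal_genM/ideal_gen_prod.
Qed.

End Ideals.

Lemma rmorph_ideal_gen (R T : comNzRingType) (f : {rmorphism R -> T})
    (S : R -> Prop) (x : R) :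
  (forall y, S y -> f y = 0) -> ideal_gen S x -> f x = 0.
Proof.
move=> fS; apply: (ideal_gen_ind (P := fun x => f x = 0)); first exact: rmorph0.
  by move=> y z fy fz; rewrite rmorphD fy fz addr0.
by move=> y z /fS fz; rewrite rmorphM fz mulr0.
Qed.

(** * Triangular factorization of the leading minors *)

Section Elimination.
Variables (R : comNzRingType) (q : nat) (b : 'M[R]_q) (n : 'I_q).
Let w := widen_ord (ltn_ord n).

(** Below the diagonal stand the Gaussian multipliers: the entry of column [j] at stage [j], divided
    by the pivot -1. *)
Definition elim_lower : 'M[R]_n.+1 := \matrix_(i, j)
  if i == j then 1 else
  if (j < i)%N then - path_sum b (w j) (w i) (w j) else 0.

(** Row [i] is frozen at stage [i], when it becomes the pivot row. *)
Definition elim_upper : 'M[R]_n.+1 :=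
  \matrix_(i, j) path_sum b (w i) (w i) (w j).

(** An exact identity, before any reduction modulo the ideal: entrywise it is [path_sum_expand] at
    stage [i], solved for the entry of [b]. *)
Lemma elim_factor : mxsub w w b = elim_lower *m elim_upper.
Proof.
apply/matrixP => i j; rewrite !mxE (bigD1 i) //= !mxE eqxx mul1r.
rewrite path_sum_expand -addrA -[LHS]addr0; congr (_ + _); apply/esym/eqP.
rewrite addrC addr_eq0 -sumrN.
(* The columns beyond [i] contribute nothing, since the lower factor vanishes there. *)
rewrite (bigID (fun k : 'I_n.+1 => (k < i)%N)) /= [X in _ + X]big1 => [|k].
  rewrite addr0; apply/eqP.
  rewrite (eq_bigl (fun k : 'I_q => (k < i)%N && (k < n.+1)%N)); last first.
    by move=> k; rewrite andb_idr // => ki; apply: ltn_trans ki (ltn_ord i).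
  rewrite (big_ord_narrow_cond (ltn_ord n)) /=; apply: eq_big => k.
    by rewrite andb_idl // => ki; rewrite -val_eqE neq_ltn ki.
  by move=> /andP[ki ki']; rewrite !mxE eq_sym (negPf ki) ki' mulNr.
by move=> /andP[ki ki']; rewrite !mxE eq_sym (negPf ki) (negPf ki') mul0r.
Qed.

Lemma det_elim_lower : \det elim_lower = 1.
Proof.
rewrite det_trig; first by apply: big1 => i _; rewrite mxE eqxx.
apply/is_trig_mxP => i j ij; rewrite mxE -val_eqE (ltn_eqF ij).
by rewrite ltnNge (ltnW ij).
Qed.

(* The entries of the upper factor below the diagonal vanish modulo the ideal,
   and its diagonal entries but the last one are -1. *)
Lemma det_mxsub_path_sum :
  ideal_gen (fun x => exists2 k : 'I_q, (k < n)%N & x = 1 + path_sum b k k k)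
    (\det (mxsub w w b) - (-1) ^+ n * path_sum b n n n).
Proof.
set S := fun x => _.
have SP (k : 'I_q) : (k < n)%N -> ideal_gen S (1 + path_sum b k k k).
  by move=> kn; apply: sub_ideal_gen; exists k.
(* [T] is congruent to [elim_upper] and exactly triangular. Its last diagonal entry is kept, because
   only the generators with index below [n] are available. *)
pose T : 'M[R]_n.+1 := \matrix_(i, j)
  if (j < i)%N then 0
  else if (i == j) && (i < n)%N then -1 else elim_upper i j.
have -> : (-1) ^+ n * path_sum b n n n = \det T.
  rewrite -det_tr det_trig; last first.
    by apply/is_trig_mxP => i j ij; rewrite !mxE ij.
  rewrite big_ord_recr /= !mxE ltnn andbF.
  have -> : w ord_max = n by apply: val_inj.
  congr (_ * _); transitivity (\prod_(i < n) (-1 : R)).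
    by rewrite prodr_const card_ord.
  by apply: eq_bigr => i _; rewrite !mxE ltnn eqxx /= ltn_ord.
rewrite elim_factor det_mulmx det_elim_lower mul1r.
apply: ideal_gen_det => i j; rewrite !mxE; case: ifP => [ji|_].
  have [|c ->] := @path_sum_below _ _ b (w i) (w i) (w j); first exact: ji.
  rewrite subr0; apply/ideal_genM/SP => /=.
  (* From [j < i <= n], the generator at [j] has index strictly below [n]. *)
  exact: leq_trans ji (ltnSE (ltn_ord i)).
case: ifP => [/andP[/eqP<- i_n]|_]; last by rewrite subrr; apply: ideal_gen0.
by rewrite opprK addrC; apply: SP.
Qed.

End Elimination.

(** * Lexicographic comparison and supports of ideal elements *)

Section MonomialOrder.
Variables (n : nat) (le : rel 'I_n).
Hypothesis le_total : total le.
Implicit Types (m : 'X_{1..n}).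

(** If the deciding indeterminates of the two comparisons differ, totality puts one above the other,
    and there the exponents would have to agree. *)
Lemma mlex_asym m1 m2 : mlex le m1 m2 -> ~~ mlex le m2 m1.
Proof.
move=> /existsP[i /andP[mi /forallP hi]]; apply/negP.
move=> /existsP[j /andP[mj /forallP hj]].
have [ij|ij] := eqVneq i j; first by rewrite ij ltnNge (ltnW mj) in mi.
case/orP: (le_total i j) => l.
  by move: (hi j); rewrite eq_sym ij l /= => /eqP e; rewrite e ltnn in mj.
by move: (hj i); rewrite ij l /= => /eqP e; rewrite e ltnn in mi.
Qed.

Lemma lead_monom_uniq (R : comNzRingType) (p : {mpoly R[n]}) m1 m2 :
  lead_monom (mlex le) p m1 -> lead_monom (mlex le) p m2 -> m1 = m2.
Proof.
move=> [p1 l1] [p2 l2]; apply/eqP/negPn/negP => m12.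
by have := mlex_asym (l2 _ p1 m12); rewrite l1 // eq_sym.
Qed.

End MonomialOrder.

(** Each monomial of a combination is a multiple of a monomial of some generator. For monomial
    generators this yields the usual divisibility criterion. *)
Lemma msupp_ideal_gen (n : nat) (R : comNzRingType) (S : {mpoly R[n]} -> Prop)
    (P : 'X_{1..n} -> Prop) :
  (forall t m m', S t -> m \in msupp t -> P (m' + m)%MM) ->
  forall p, ideal_gen S p -> forall m, m \in msupp p -> P m.
Proof.
move=> SP; apply: ideal_gen_ind => [m|p r Pp Pr m|p r Sr m].
- by rewrite msupp0.
- by move=> /msuppD_le; rewrite mem_cat => /orP[/Pp|/Pr].
by move=> /msuppM_le/allpairsP[[m1 m2] /= [_ m2r ->]]; apply: SP Sr m2r.
Qed.

(** * Gröbner bases of systems solved for their largest indeterminates *)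

Section SolvedForm.
Variables (n : nat) (R : comNzRingType) (le : rel 'I_n) (J : finType).
Variables (d : J -> 'I_n) (f : J -> {mpoly R[n]}).
Hypothesis le_anti : antisymmetric le.
Hypothesis le_total : total le.
Hypothesis d_inj : injective d.
Hypothesis le_d : forall i j, i \notin codom d -> le i (d j).
Implicit Types (m : 'X_{1..n}) (p : {mpoly R[n]}) (j : J).

Definition avoids m := [forall j, m (d j) == 0%N].

Definition poly_avoids p := all avoids (msupp p).

Hypothesis f_avoids : forall j, poly_avoids (f j).

Let lt := mlex le.
Let g j := 'X_(d j) + f j.

Lemma poly_avoids0 : poly_avoids 0.
Proof. by rewrite /poly_avoids msupp0. Qed.

Lemma poly_avoids1 : poly_avoids 1.
Proof.
by rewrite /poly_avoids msupp1 /= andbT; apply/forallP => j; rewrite mnmE.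
Qed.

Lemma poly_avoidsD p1 p2 :
  poly_avoids p1 -> poly_avoids p2 -> poly_avoids (p1 + p2).
Proof.
move=> a1 a2; apply/allP => m /msuppD_le.
by rewrite mem_cat => /orP[/(allP a1)|/(allP a2)].
Qed.

Lemma poly_avoidsM p1 p2 :
  poly_avoids p1 -> poly_avoids p2 -> poly_avoids (p1 * p2).
Proof.
move=> a1 a2; apply/allP => _ /msuppM_le/allpairsP[[m1 m2] /= [h1 h2 ->]].
apply/forallP => j; rewrite mnmDE addn_eq0.
by rewrite (forallP (allP a1 _ h1)) (forallP (allP a2 _ h2)).
Qed.

Lemma poly_avoidsX i : i \notin codom d -> poly_avoids 'X_i.
Proof.
move=> id; rewrite /poly_avoids msuppX /= andbT; apply/forallP => j.
by rewrite mnm1E eqb0; apply: contra id => /eqP->; apply: codom_f.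
Qed.

(** Every indeterminate above [d j] is some [d k], which occurs in neither monomial unless [k = j];
    so [d j] decides the comparison. *)
Lemma avoids_lt m j : avoids m -> lt m U_(d j)%MM.
Proof.
move=> /forallP am; apply/existsP; exists (d j).
rewrite (eqP (am j)) mnm1E eqxx /=; apply/forallP => i; apply/implyP.
move=> /andP[ij le_i]; rewrite mnm1E eq_sym in ij *; rewrite (negPf ij).
have [/codomP[k ->]|id] := boolP (i \in codom d); first exact: am.
by move: ij; rewrite (@le_anti i (d j)) ?eqxx // le_i le_d.
Qed.

(** The deciding indeterminate occurs in [m], hence is no [d j]; all [d j] then lie above it, where
    the two monomials agree. *)
Lemma lt_avoids m m' : lt m' m -> avoids m -> avoids m'.
Proof.
move=> /existsP[i /andP[mi /forallP hi]] /forallP am; apply/forallP => j.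
have id : i \notin codom d.
  by apply/codomP => -[k ik]; move: mi; rewrite ik (eqP (am k)).
move: (hi (d j)); rewrite le_d // andbT.
have -> : d j != i by apply: contra id => /eqP<-; apply: codom_f.
by move=> /eqP->; apply: am.
Qed.

Lemma avoidsPn m : reflect (exists j, (U_(d j) <= m)%MM) (~~ avoids m).
Proof.
rewrite negb_forall.
by apply: (iffP existsP) => -[j jm]; exists j; rewrite lep1mP in jm *.
Qed.

Definition solve : n.-tuple {mpoly R[n]} :=
  [tuple if [pick j | d j == i] is Some j then - f j else 'X_i | i < n].

Lemma solve_avoids p : poly_avoids p -> p \mPo solve = p.
Proof.
move=> ap; rewrite comp_mpolyEX [RHS]mpolyE; apply: eq_big_seq => m mp.
congr (_ *: _); rewrite comp_mpolyX mpolyXE_id; apply: eq_bigr => i _.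
rewrite tnth_mktuple; case: pickP => // j /eqP <-.
by rewrite (eqP (forallP (allP ap _ mp) j)) !expr0.
Qed.

(** The substitution sends ['X_(d j)] to [- f j] and fixes [f j]. *)
Lemma solve_gen j : g j \mPo solve = 0.
Proof.
rewrite comp_mpolyD [f j \mPo _]solve_avoids // comp_mpolyXU -tnth_nth tnth_mktuple.
case: pickP => [k /eqP/d_inj->|/(_ j)]; last by rewrite eqxx.
by rewrite addNr.
Qed.

Lemma mcoeff_gen j k : (g j)@_U_(d k) = (j == k)%:R.
Proof.
rewrite mcoeffD mcoeffXU (inj_eq d_inj).
have /eqP-> : (f j)@_U_(d k) == 0; last by rewrite addr0.
rewrite mcoeff_eq0; apply/negP => /(allP (f_avoids j))/forallP/(_ k).
by rewrite mnm1E eqxx.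
Qed.

Lemma msupp_gen j m : m \in msupp (g j) -> m != U_(d j)%MM -> avoids m.
Proof.
move=> /msuppD_le; rewrite msuppX mem_cat inE => /orP[->//|mf] _.
exact: (allP (f_avoids j)).
Qed.

Lemma lead_gen j : lead_monom lt (g j) U_(d j)%MM.
Proof.
split=> [|m mg mj]; first by rewrite mcoeff_msupp mcoeff_gen eqxx oner_neq0.
exact/avoids_lt/(msupp_gen mg).
Qed.

Lemma init_term_gen j : init_term lt (g j) 'X_(d j).
Proof. by exists U_(d j)%MM; [apply: lead_gen|rewrite mcoeff_gen eqxx scale1r]. Qed.

Lemma gen_neq0 j : g j != 0.
Proof.
by apply/eqP => g0; have := lead_gen j; rewrite g0 => -[]; rewrite msupp0.
Qed.

Variable I : {mpoly R[n]} -> Prop.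
Hypothesis I_gen :
  forall p, I p <-> ideal_gen (fun x => exists j, x = g j) p.

Lemma solve_ideal p : I p -> p \mPo solve = 0.
Proof.
by move=> /I_gen; apply: (@rmorph_ideal_gen _ _ (comp_mpoly solve)) => _ [j ->];
  apply: solve_gen.
Qed.

Lemma gen_in_ideal j : I (g j).
Proof. by apply/I_gen/sub_ideal_gen; exists j. Qed.

Lemma poly_avoids_ideal p : I p -> poly_avoids p -> p = 0.
Proof. by move=> /solve_ideal Ip /solve_avoids <-. Qed.

(** If the leading monomial avoided all [d j], so would the smaller ones by [lt_avoids], and [p]
    would be 0. *)
Lemma lead_monom_ideal p m :
  I p -> lead_monom lt p m -> exists j, (U_(d j) <= m)%MM.
Proof.
move=> Ip [mp l]; apply/avoidsPn/negP => am.
suff p0 : p = 0 by rewrite p0 msupp0 in mp.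
apply: poly_avoids_ideal => //; apply/allP => m' m'p.
by have [->//|m'm] := eqVneq m' m; apply: lt_avoids (l _ m'p m'm) am.
Qed.

Let G := [seq g j | j <- enum J].

Lemma memG p : reflect (exists j, p = g j) (p \in G).
Proof.
apply: (iffP mapP) => [[j _ ->]|[j ->]]; first by exists j.
by exists j; rewrite ?mem_enum.
Qed.

(** The generators are monic, so divisibility of monomials suffices although the coefficients only
    form a ring. *)
Lemma solved_groebner : groebner_basis lt I G.
Proof.
split=> [_ /memG[j ->]|p]; first exact: gen_in_ideal.
split; apply: ideal_gen_sub => t.
  move=> [_ /memG[j ->] tg]; apply: sub_ideal_gen; exists (g j).
  by split=> //; [apply: gen_in_ideal|apply: gen_neq0].
move=> [r [Ir _ [m lm ->]]]; have [j jm] := lead_monom_ideal Ir lm.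
rewrite -(submK jm) mpolyXD scalerAl; apply/ideal_genM/sub_ideal_gen.
by exists (g j); [apply/memG; exists j|apply: init_term_gen].
Qed.

Lemma solved_reduced_groebner : reduced_groebner_basis lt I G.
Proof.
split=> [|_ /memG[j ->]|]; first exact: solved_groebner.
  by exists U_(d j)%MM; [apply: lead_gen|rewrite mcoeff_gen eqxx].
move=> _ _ m m' /memG[j ->] /memG[k ->] kj mj lk.
rewrite (lead_monom_uniq le_total lk (lead_gen k)) lep1mP negbK.
have [mE|/(msupp_gen mj)/forallP//] := eqVneq m U_(d j)%MM.
rewrite mE mnm1E (inj_eq d_inj) eqb0.
by apply: contra kj => /eqP->.
Qed.

(** Each ['X_(d j)] must be the leading monomial of some element of [G']. That element differs from
    [g j] by a member of the ideal that avoids all [d k], hence by 0. *)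
Lemma solved_reduced_groebner_uniq G' : reduced_groebner_basis lt I G' -> G' =i G.
Proof.
move=> [[G'I G'init] G'lead G'red].
have hit j : exists2 h, h \in G' & lead_monom lt h U_(d j)%MM.
  have : init_ideal lt I 'X_(d j).
    apply: sub_ideal_gen; exists (g j).
    by split; [apply: gen_in_ideal|apply: gen_neq0|apply: init_term_gen].
  move=> /G'init Xj.
  have : exists h m, [/\ h \in G', lead_monom lt h m & (m <= U_(d j))%MM].
    have := msupp_ideal_gen (P := fun m0 => exists h m,
      [/\ h \in G', lead_monom lt h m & (m <= m0)%MM]) _ Xj.
    apply; last by rewrite msuppX inE.
    move=> t m m' [h hG [m0 lm0 ->]] /msuppZ_le; rewrite msuppX inE => /eqP->.
    by exists h, m0; split=> //; apply: lem_addl.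
  move=> [h [m [hG lm mj]]]; exists h => //.
  (* Some ['X_(d k)] divides [m], which divides ['X_(d j)]; so all three coincide. *)
  have [k km] := lead_monom_ideal (G'I _ hG) lm.
  have jk : j = k.
    apply/d_inj/eqP; move: (lepm_trans km mj).
    by rewrite lep1mP mnm1E eqb0 negbK.
  rewrite -jk in km; suff -> : U_(d j)%MM = m by [].
  move/mnm_lepP: km => km; move/mnm_lepP: mj => mj.
  by apply/mnmP => i; apply/eqP; rewrite eqn_leq km mj.
have G'gen h j : h \in G' -> lead_monom lt h U_(d j)%MM -> h = g j.
  move=> hG lh; apply/eqP; rewrite -subr_eq0; apply/eqP.
  apply: poly_avoids_ideal.
    by apply/I_gen/ideal_genB; apply/I_gen; [apply: G'I|apply: gen_in_ideal].
  have hj : h@_U_(d j) = 1.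
    by have [m lm <-] := G'lead _ hG; rewrite (lead_monom_uniq le_total lh lm).
  apply/allP => m mhg; have mj : m != U_(d j)%MM.
    apply: contraL mhg => /eqP->.
    by rewrite mcoeff_msupp mcoeffB hj mcoeff_gen eqxx subrr eqxx.
  have := msuppB_le mhg; rewrite mem_cat => /orP[mh|mg].
    apply/forallP => k; have [<-|jk] := eqVneq j k.
      (* A monomial below ['X_(d j)] has a smaller exponent somewhere, which can only be 0 at [d j].
         The other [d k] are excluded by reducedness of [G']. *)
      have /existsP[i /andP[mi _]] := lh.2 _ mh mj.
      by move: mi; rewrite mnm1E; case: eqP => // <-; case: (m (d j)).
    have [h' h'G lh'] := hit k.
    have /(G'red _ _ _ _ hG h'G)/(_ mh lh') : h' != h.
      apply: contra jk => /eqP e; rewrite e in lh'.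
      have /eqP := lead_monom_uniq le_total lh lh'.
      by rewrite eq_mnm1 (inj_eq d_inj).
    by rewrite lep1mP negbK.
  exact: msupp_gen mg mj.
move=> h; apply/idP/memG => [hG|[j ->]].
  have [m lm _] := G'lead _ hG; have [j jm] := lead_monom_ideal (G'I _ hG) lm.
  (* The leading monomial of [h'] divides that of [h], so reducedness forces [h' = h]. *)
  have [h' h'G lh'] := hit j; exists j.
  have <- := G'gen _ _ h'G lh'; apply/eqP/negPn/negP => hh'.
  have := G'red _ _ _ _ hG h'G _ lm.1 lh'; rewrite jm => /(_ _)/negP.
  by apply=> //; rewrite eq_sym.
by have [h' h'G /(G'gen _ _ h'G) <-] := hit j.
Qed.

End SolvedForm.

(** * The ideal of the minors in solved form *)

Section MinorIdeal.
Variable q : nat.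
Implicit Types (i j k n : 'I_q).

Let d j := mxvec_index j j.
Let tail n := C n - B q n n.

Lemma mxvec_index_inj i j k n :
  mxvec_index i j = mxvec_index k n -> (i, j) = (k, n).
Proof. by move=> /cast_ord_inj/enum_rank_inj. Qed.

Lemma offdiag_codom i j : (mxvec_index i j \notin codom d) = (i != j).
Proof.
congr (~~ _); apply/codomP/eqP => [[k /mxvec_index_inj[-> ->]]|->] //.
by exists j.
Qed.

Lemma B_avoids i j : i != j -> poly_avoids d (B q i j).
Proof. by move=> ij; rewrite mxE; apply: poly_avoidsX; rewrite offdiag_codom. Qed.

(** No step of the walk is a loop: the outer steps by hypothesis, the inner ones by
    [admissible_neq]. The default of [head] makes the first condition read [i != j] when [s] is
    empty. *)
Lemma path_weight_avoids i s j :
  i != head j s -> last i s != j -> admissible (map val s) ->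
  poly_avoids d (path_weight (B q) i s j).
Proof.
elim: s i => [|k s IH] i ik kj adm.
  by rewrite /path_weight /= big_seq1; apply: B_avoids.
rewrite /path_weight /= big_cons; apply: poly_avoidsM; first exact: B_avoids.
apply: IH => //; last exact: (@admissible_catr [:: val k]).
case: s {ik} adm kj => [|l s] //=.
by move=> /(@admissible_neq [::]); rewrite val_eqE.
Qed.

Lemma tail_avoids n : poly_avoids d (tail n).
Proof.
have nil_n : [::] \in adm_seqs n.
  by rewrite mem_adm_seqs andbT; apply/admissibleP.
(* The empty sequence contributes exactly the subtracted [B q n n]. In the others all entries are
   below [n], so the first and last steps are off-diagonal. *)
rewrite /tail /C (bigD1_seq [::] nil_n (adm_seqs_uniq n)) /=.
rewrite big_seq1 [X in poly_avoids _ X]addrC addKr.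
rewrite big_seq_cond.
apply: (big_ind (poly_avoids d)); first exact: poly_avoids0.
  exact: poly_avoidsD.
move=> s /andP[]; rewrite mem_adm_seqs => /andP[adm /allP sn] s0.
apply: path_weight_avoids => //.
  case: s s0 sn {adm} => //= k s _ /(_ k); rewrite inE eqxx => /(_ isT).
  by move=> kn; rewrite -val_eqE gtn_eqF.
case/lastP: s s0 sn {adm} => // s k _ /(_ k).
rewrite mem_rcons inE eqxx last_rcons => /(_ isT) kn.
by rewrite -val_eqE ltn_eqF.
Qed.

(** By [minorE] the two families of generators are related by a triangular system with signs on the
    diagonal, which is inverted by strong induction on [n]. *)
Lemma minor_ideal_gen p :
  minor_ideal p <-> ideal_gen (fun x => exists n, x = 1 + C n) p.
Proof.
pose S (n : 'I_q) x := exists2 k : 'I_q, (k < n)%N & x = 1 + C k.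
have minorE n : lead_minor n - (-1) ^+ n.+1
    = (lead_minor n - (-1) ^+ n * C n) + (-1) ^+ n * (1 + C n).
  by rewrite exprS mulN1r opprK mulrDr mulr1 [X in _ = _ + X]addrC addrA addrNK.
have SC n : ideal_gen (S n) (lead_minor n - (-1) ^+ n * C n).
  exact: det_mxsub_path_sum.
have gen_minor n : ideal_gen (fun x => exists n, x = 1 + C n)
    (lead_minor n - (-1) ^+ n.+1).
  rewrite minorE; apply: ideal_genD.
    by apply: ideal_gen_sub (SC n) => y [k _ ->]; apply: sub_ideal_gen; exists k.
  by apply/ideal_genM/sub_ideal_gen; exists n.
have minor_gen n : minor_ideal (1 + C n).
  have [m] := ubnP (val n); elim: m n => // m IH n; rewrite ltnS => nm.
  have -> : 1 + C n = (-1) ^+ n * ((lead_minor n - (-1) ^+ n.+1)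
                                   - (lead_minor n - (-1) ^+ n * C n)).
    rewrite minorE addrAC subrr add0r mulrA -exprMn mulrNN mulr1 expr1n.
    by rewrite mul1r.
  apply/ideal_genM/ideal_genB; first by apply: sub_ideal_gen; exists n.
  apply: ideal_gen_sub (SC n) => _ [k kn ->].
  by apply: IH; apply: leq_trans nm.
by split; apply: ideal_gen_sub => _ [n ->]; [apply: gen_minor|apply: minor_gen].
Qed.

Lemma one_add_C n : 1 + C n = 'X_(d n) + (1 + tail n).
Proof. by rewrite /tail mxE addrCA [_ + (C n - _)]addrC addrNK. Qed.

Lemma gen_tail_avoids n : poly_avoids d (1 + tail n).
Proof. by apply: poly_avoidsD (tail_avoids n); apply: poly_avoids1. Qed.

End MinorIdeal.

Theorem theorem4p5 (q : nat) (hq : (1 <= q)%N) (le : rel 'I_(q * q))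
    (le_anti : antisymmetric le) (le_trans : transitive le) (le_total : total le)
    (le_diag : forall i k l : 'I_q, k != l ->
       le (mxvec_index k l) (mxvec_index i i)) :
  let G := [seq 1 + C n | n <- enum 'I_q] in
  reduced_groebner_basis (mlex le) (@minor_ideal q) G /\
  (forall G' : seq {mpoly int[q * q]},
     reduced_groebner_basis (mlex le) (@minor_ideal q) G' -> G' =i G).
Proof.
set G := [seq _ | n <- _] => /=.
pose d (j : 'I_q) := mxvec_index j j.
pose f (n : 'I_q) : {mpoly int[q * q]} := 1 + (C n - B q n n).
(* The constant 1 joins the off-diagonal part, which puts the generators in solved form. *)
have GE : G = [seq 'X_(d n) + f n | n <- enum 'I_q].
  by apply: eq_map => n; apply: one_add_C.
have d_inj : injective d by move=> j k /mxvec_index_inj[].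
have le_d i j : i \notin codom d -> le i (d j).
  by case/mxvec_indexP: i => k l; rewrite offdiag_codom; apply: le_diag.
have f_avoids n : poly_avoids d (f n) by apply: gen_tail_avoids.
have I_gen p : minor_ideal p <->
    ideal_gen (fun x => exists n, x = 'X_(d n) + f n) p.
  apply: (iff_trans (minor_ideal_gen p)).
  by split; apply: ideal_gen_sub => _ [n ->]; apply: sub_ideal_gen; exists n;
    rewrite one_add_C.
rewrite GE; split; first exact: solved_reduced_groebner.
by move=> G'; apply: solved_reduced_groebner_uniq.
Qed.
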